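(* Let $H$ be a compact quantum group with antipode $S$ and let $\varphi:H\to\mathbb{C}$ be the associated normal integral. Then the hermitian form $\langle x,y\rangle_\varphi=\varphi(S(y^\circ)x)$, $x,y\in H$, is positive definite.
   Context: Everything is over $\mathbb{C}$. A $\circ$-structure on a coalgebra is a conjugate linear involution $c\mapsto c^\circ$ with $\Delta(c^\circ)=\sum c_2^\circ\otimes c_1^\circ$. A $\circ$-Hopf algebra is a Hopf algebra $H$ with a $\circ$-structure on its underlying coalgebra such that $(xy)^\circ=x^\circ y^\circ$. A unitary inner product on a right $H$-comodule $V$ (with coaction $v\mapsto\sum v_0\otimes v_1$) is an inner product (linear in the first, conjugate linear in the second variable) with $\sum\langle u_0,v\rangle u_1=\sum\langle u,v_0\rangle v_1^\circ$ for all $u,v$. A compact quantum group is a $\circ$-Hopf algebra $H$ such that every right $H$-comodule admits a unitary inner product. Such an $H$ is cosemisimple, i.e. the direct sum of its simple subcoalgebras, one of which is $\mathbb{C}1$; the normal integral $\varphi:H\to\mathbb{C}$ is the projection of $H$ onto $\mathbb{C}1\cong\mathbb{C}$ along the sum of the other simple subcoalgebras; it satisfies $\sum\varphi(x_1)x_2=\varphi(x)1=\sum x_1\varphi(x_2)$ and $\varphi(1)=1$. The form $\langle\cdot,\cdot\rangle_\varphi$ is positive definite if $\langle x,x\rangle_\varphi>0$ for all $x\ne0$. *)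

(* Defs.v *)
From HB Require Import structures.
From mathcomp Require Import all_boot all_order all_algebra generic_quotient.
From mathcomp Require Import sesquilinear complex boolp reals.

Set Implicit Arguments.
Unset Strict Implicit.
Unset Printing Implicit Defensive.

Import Order.TTheory GRing.Theory Num.Theory Num.Def.
Local Open Scope ring_scope.
Local Open Scope quotient_scope.

(* V ⊗ W is the quotient of the formal finite sums of pairs (v, w) by the     *)
(* congruence generated by the usual relations. The formal sum                *)
(* v_1 ⊗ w_1 + ... + v_n ⊗ w_n is the sequence of its pairs; no integer or    *)
(* scalar coefficients are needed, since they can be absorbed in the v_i.     *)

Section TensorProduct.
Variables (K : comNzRingType) (V W : lmodType K).

Inductive tensor_rel : seq (V * W) -> seq (V * W) -> Prop :=
| tensor_refl s : tensor_rel s s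
| tensor_sym s t : tensor_rel s t -> tensor_rel t s
| tensor_trans s t u : tensor_rel s t -> tensor_rel t u -> tensor_rel s u
| tensor_cat s s' t t' :
    tensor_rel s s' -> tensor_rel t t' -> tensor_rel (s ++ t) (s' ++ t')
| tensor_catC s t : tensor_rel (s ++ t) (t ++ s)
| tensor_0 w : tensor_rel [:: (0, w)] [::]
| tensor_Dl v v' w : tensor_rel [:: (v + v', w)] [:: (v, w); (v', w)]
| tensor_Dr v w w' : tensor_rel [:: (v, w + w')] [:: (v, w); (v, w')]
| tensor_Z a v w : tensor_rel [:: (a *: v, w)] [:: (v, a *: w)].

Definition tensor_relb (s t : seq (V * W)) : bool := `[< tensor_rel s t >].

Fact tensor_relb_refl : reflexive tensor_relb.
Proof. by move=> s; apply/asboolP; exact: tensor_refl. Qed.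

Fact tensor_relb_sym : symmetric tensor_relb.
Proof. by move=> s t; apply/asboolP/asboolP => /tensor_sym. Qed.

Fact tensor_relb_trans : transitive tensor_relb.
Proof.
by move=> t s u /asboolP st /asboolP tu; apply/asboolP; apply: tensor_trans tu.
Qed.

Canonical tensor_equiv :=
  EquivRel tensor_relb tensor_relb_refl tensor_relb_sym tensor_relb_trans.

Definition tensor : Type := {eq_quot tensor_equiv}.
HB.instance Definition _ := Choice.on tensor.
HB.instance Definition _ := EqQuotient.on tensor.

Fact tensor_eqP (s t : seq (V * W)) :
  (\pi_tensor s = \pi_tensor t) <-> tensor_rel s t.
Proof. by split=> [/eqmodP/asboolP|] // st; apply/eqmodP/asboolP. Qed.

Fact tensor_piP (P : tensor -> Prop) :
  (forall s : seq (V * W), P (\pi_tensor s)) -> forall t, P t.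
Proof. by move=> Ps t; rewrite -[t]reprK; apply: Ps. Qed.

Definition tensor_pure (v : V) (w : W) : tensor := \pi_tensor [:: (v, w)].

Definition tensor_zero : tensor := \pi_tensor [::].
Definition tensor_add (s t : tensor) : tensor := \pi_tensor (repr s ++ repr t).
Definition tensor_scale (a : K) (s : tensor) : tensor :=
  \pi_tensor [seq (a *: p.1, p.2) | p <- repr s].

Fact tensor_repr_pi s : tensor_rel (repr (\pi_tensor s)) s.
Proof. by apply/tensor_eqP; rewrite reprK. Qed.

Fact tensor_add_pi s t :
  tensor_add (\pi_tensor s) (\pi_tensor t) = \pi_tensor (s ++ t).
Proof. by apply/tensor_eqP; apply: tensor_cat; apply: tensor_repr_pi. Qed.

Fact tensor_rel_scale a s t : tensor_rel s t ->
  tensor_rel [seq (a *: p.1, p.2) | p <- s] [seq (a *: p.1, p.2) | p <- t].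
Proof.
elim=> {s t} [s|s t _ IH|s t u _ IH1 _ IH2|s s' t t' _ IH1 _ IH2|s t|w
  |v v' w|v w w'|b v w] /=.
- exact: tensor_refl.
- exact: tensor_sym.
- exact: tensor_trans IH1 IH2.
- by rewrite !map_cat; apply: tensor_cat.
- by rewrite !map_cat; apply: tensor_catC.
- by rewrite scaler0; apply: tensor_0.
- by rewrite scalerDr; apply: tensor_Dl.
- exact: tensor_Dr.
- by rewrite !scalerA mulrC -scalerA; apply: tensor_Z.
Qed.

Fact tensor_scale_pi a s :
  tensor_scale a (\pi_tensor s) = \pi_tensor [seq (a *: p.1, p.2) | p <- s].
Proof. by apply/tensor_eqP/tensor_rel_scale/tensor_repr_pi. Qed.

Fact tensor_addA : associative tensor_add.
Proof.
elim/tensor_piP=> s; elim/tensor_piP=> t; elim/tensor_piP=> u.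
by rewrite !tensor_add_pi catA.
Qed.

Fact tensor_addC : commutative tensor_add.
Proof.
elim/tensor_piP=> s; elim/tensor_piP=> t.
by rewrite !tensor_add_pi; apply/tensor_eqP/tensor_catC.
Qed.

Fact tensor_add0 : left_id tensor_zero tensor_add.
Proof. by elim/tensor_piP=> s; rewrite tensor_add_pi. Qed.

Fact tensor_scaleDl s :
  {morph tensor_scale^~ s : a b / a + b >-> tensor_add a b}.
Proof.
move: s; elim/tensor_piP=> s a b; rewrite !tensor_scale_pi tensor_add_pi.
apply/tensor_eqP; elim: s => [|[v w] s IH] /=; first exact: tensor_refl.
set f := fun c (p : V * W) => (c *: p.1, p.2); rewrite -!/(f _) in IH *.
set A := map (f a) s in IH *; set B := map (f b) s in IH *.
rewrite scalerDl.
apply: tensor_trans (tensor_cat (tensor_Dl (a *: v) (b *: v) w) IH) _.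
have -> : A ++ (b *: v, w) :: B = (A ++ [:: (b *: v, w)]) ++ B by rewrite -catA.
apply: (@tensor_cat [:: (a *: v, w)] [:: (a *: v, w)]
  (([:: (b *: v, w)] ++ A) ++ B)); first exact: tensor_refl.
by apply: tensor_cat; [exact: tensor_catC | exact: tensor_refl].
Qed.

Fact tensor_scale0 s : tensor_scale 0 s = tensor_zero.
Proof.
move: s; elim/tensor_piP=> s; rewrite tensor_scale_pi; apply/tensor_eqP.
elim: s => [|[v w] s IH] /=; first exact: tensor_refl.
rewrite scale0r -cat1s -[X in tensor_rel _ X]cat0s.
exact: tensor_cat (tensor_0 _) IH.
Qed.

Fact tensor_scale1 : left_id 1 tensor_scale.
Proof.
elim/tensor_piP=> s; rewrite tensor_scale_pi; congr (\pi_tensor _).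
by rewrite -[RHS]map_id; apply: eq_map => -[v w] /=; rewrite scale1r.
Qed.

Definition tensor_opp (s : tensor) : tensor := tensor_scale (-1) s.

Fact tensor_addN : left_inverse tensor_zero tensor_opp tensor_add.
Proof.
move=> s; rewrite -[X in tensor_add _ X]tensor_scale1 -tensor_scaleDl addNr.
exact: tensor_scale0.
Qed.

HB.instance Definition _ := GRing.isZmodule.Build tensor
  tensor_addA tensor_addC tensor_add0 tensor_addN.

Lemma tensor_piD (s t : seq (V * W)) :
  \pi_tensor s + \pi_tensor t = \pi_tensor (s ++ t) :> tensor.
Proof. exact: tensor_add_pi. Qed.

Fact tensor_scaleA a b s :
  tensor_scale a (tensor_scale b s) = tensor_scale (a * b) s.
Proof.
move: s; elim/tensor_piP=> s; rewrite !tensor_scale_pi -map_comp.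
by congr (\pi_tensor _); apply: eq_map => -[v w] /=; rewrite scalerA.
Qed.

Fact tensor_scaleDr : right_distributive tensor_scale +%R.
Proof.
move=> a; elim/tensor_piP=> s; elim/tensor_piP=> t.
by rewrite tensor_piD !tensor_scale_pi tensor_piD map_cat.
Qed.

HB.instance Definition _ := GRing.Zmodule_isLmodule.Build K tensor
  tensor_scaleA tensor_scale1 tensor_scaleDr tensor_scaleDl.

End TensorProduct.

Reserved Notation "x ⊗ y" (at level 40, left associativity).
Notation "V ⊗ W" := (tensor V%type W%type) : type_scope.
Notation "v ⊗ w" := (tensor_pure v w) : ring_scope.

(* If t = \sum_i v_i ⊗ w_i then tensor_lift f t = \sum_i f v_i w_i, provided  *)
(* that f is balanced. Hence tensor_lift (fun x y => E) t is the Sweedler     *)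
(* expression in which x and y are the two legs of t. Balanced maps with      *)
(* values in an abelian group cover both the bilinear maps and the            *)
(* conjugate-bilinear ones.                                                   *)
Section TensorLift.
Variables (K : comNzRingType) (V W : lmodType K) (U : zmodType).

Definition balanced (f : V -> W -> U) : Prop :=
  [/\ forall v v' w, f (v + v') w = f v w + f v' w,
      forall v w w', f v (w + w') = f v w + f v w'
    & forall a v w, f (a *: v) w = f v (a *: w)].

Definition tensor_lift (f : V -> W -> U) (t : V ⊗ W) : U :=
  \sum_(p <- repr t) f p.1 p.2.

Lemma tensor_liftE f s : balanced f ->
  tensor_lift f (\pi_(V ⊗ W) s) = \sum_(p <- s) f p.1 p.2.
Proof.
case=> fDl fDr fZ.
rewrite /tensor_lift; move: (repr _) (tensor_repr_pi s) => s'.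
elim=> {s s'}
  [//|s t _ ->//|s t u _ -> _ ->//|s s' t t' _ + _|s t|w|v v' w|v w w'|a v w].
- by rewrite !big_cat /= => -> ->.
- by rewrite !big_cat /= addrC.
- by rewrite big_seq1 big_nil /=; apply: (addIr (f 0 w)); rewrite -fDl !add0r.
- by rewrite !(big_cons, big_nil) /= !addr0 fDl.
- by rewrite !(big_cons, big_nil) /= !addr0 fDr.
- by rewrite !big_seq1 /= fZ.
Qed.

Lemma tensor_lift_pure f v w : balanced f -> tensor_lift f (v ⊗ w) = f v w.
Proof. by move=> bf; rewrite tensor_liftE// big_seq1. Qed.

Lemma tensor_liftD f : balanced f -> {morph tensor_lift f : s t / s + t}.
Proof.
move=> bf; elim/tensor_piP=> s; elim/tensor_piP=> t.
by rewrite tensor_piD !tensor_liftE// big_cat.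
Qed.

End TensorLift.

Lemma tensor_pure_balanced (K : comNzRingType) (V W : lmodType K) :
  balanced (@tensor_pure K V W).
Proof.
split=> [v v' w|v w w'|a v w]; rewrite ?tensor_piD; apply/tensor_eqP.
- exact: tensor_Dl.
- exact: tensor_Dr.
- exact: tensor_Z.
Qed.

Lemma tensor_scale_pure (K : comNzRingType) (V W : lmodType K) a (v : V) (w : W) :
  a *: (v ⊗ w) = (a *: v) ⊗ w.
Proof. exact: tensor_scale_pi. Qed.

Lemma tensorP (K : comNzRingType) (V W : lmodType K) (t : V ⊗ W) :
  exists s : seq (V * W), t = \sum_(p <- s) p.1 ⊗ p.2.
Proof.
elim/tensor_piP: t => s; exists s; elim: s => [|[v w] s IH]; first by rewrite big_nil.
by rewrite big_cons -IH tensor_piD.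
Qed.

Lemma tensor_liftZ (K : comNzRingType) (V W U : lmodType K) (f : V -> W -> U) a t :
    balanced f -> (forall v w, f (a *: v) w = a *: f v w) ->
  tensor_lift f (a *: t) = a *: tensor_lift f t.
Proof.
move=> bf fZ; move: t; elim/tensor_piP=> s.
rewrite [X in tensor_lift f X]tensor_scale_pi !tensor_liftE// big_map scaler_sumr.
by apply: eq_bigr => p _; rewrite fZ.
Qed.

Section TensorMaps.
Variable K : comNzRingType.

Definition tensor_map (V V' W W' : lmodType K) (f : V -> V') (g : W -> W') :
  V ⊗ W -> V' ⊗ W' := tensor_lift (fun v w => f v ⊗ g w).

Definition tensor_assoc (U V W : lmodType K) : (U ⊗ V) ⊗ W -> U ⊗ (V ⊗ W) :=
  tensor_lift (fun t w => tensor_lift (fun u v => u ⊗ (v ⊗ w)) t).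

Definition tensor_mul (A B : algType K) (s t : A ⊗ B) : A ⊗ B :=
  tensor_lift (fun a b => tensor_lift (fun c d => (a * c) ⊗ (b * d)) t) s.

Lemma tensor_map_pure (V V' W W' : lmodType K) (f : {linear V -> V'})
    (g : {linear W -> W'}) v w :
  tensor_map f g (v ⊗ w) = f v ⊗ g w.
Proof.
have [Dl Dr Z] := tensor_pure_balanced V' W'; rewrite [LHS]tensor_lift_pure//.
by split=> [v1 v2 w1|v1 w1 w2|a v1 w1] /=; rewrite ?linearD ?linearZ ?Dl ?Dr ?Z.
Qed.

Lemma tensor_assoc_pure (U V W : lmodType K) (u : U) (v : V) (w : W) :
  tensor_assoc ((u ⊗ v) ⊗ w) = u ⊗ (v ⊗ w).
Proof.
have [Dl Dr Z] := tensor_pure_balanced V W.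
have [Dl' Dr' Z'] := tensor_pure_balanced U (V ⊗ W)%type.
have b1 (w1 : W) : balanced (fun (u : U) (v : V) => u ⊗ (v ⊗ w1)).
  split=> [u1 u2 v1|u1 v1 v2|a u1 v1] /=; rewrite ?Dl ?Dl' ?Dr'//.
  by rewrite Z' tensor_scale_pure.
rewrite [LHS]tensor_lift_pure; first by rewrite tensor_lift_pure.
split=> [t1 t2 w1|t w1 w2|a t w1] /=; first by rewrite tensor_liftD.
- rewrite -big_split; apply: eq_bigr => p _ /=; by rewrite Dr Dr'.
- rewrite tensor_liftZ// => [|u1 v1]; last by rewrite tensor_scale_pure.
  rewrite scaler_sumr; apply: eq_bigr => p _ /=.
  by rewrite tensor_scale_pure Z' tensor_scale_pure Z.
Qed.

Lemma tensor_mul_pure (A B : algType K) (a c : A) (b d : B) :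
  tensor_mul (a ⊗ b) (c ⊗ d) = (a * c) ⊗ (b * d).
Proof.
have [Dl Dr Z] := tensor_pure_balanced A B.
have b1 (a1 : A) (b2 : B) : balanced (fun (c : A) (d : B) => (a1 * c) ⊗ (b2 * d)).
  split=> [x y z|x y z|k x y] /=; rewrite ?mulrDr ?Dl ?Dr//.
  by rewrite -!scalerAr Z.
rewrite [LHS]tensor_lift_pure; first by rewrite tensor_lift_pure.
split=> [x y z|x y z|k x y] /=.
- by rewrite -big_split; apply: eq_bigr => p _ /=; rewrite mulrDl Dl.
- by rewrite -big_split; apply: eq_bigr => p _ /=; rewrite mulrDl Dr.
- by apply: eq_bigr => p _ /=; rewrite -!scalerAl Z.
Qed.

End TensorMaps.

HB.mixin Record Lmodule_isCoalgebra (K : comNzRingType) C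
    of GRing.Lmodule K C := {
  comul : C -> C ⊗ C;
  counit : C -> K;
  comul_linear : linear comul;
  counit_scalar : scalar counit;
  coassoc : forall c : C,
    tensor_assoc (tensor_map comul idfun (comul c)) =
    tensor_map idfun comul (comul c);
  counitl : forall c : C,
    tensor_lift (fun c1 c2 => counit c1 *: c2) (comul c) = c;
  counitr : forall c : C,
    tensor_lift (fun c1 c2 => counit c2 *: c1) (comul c) = c
}.

#[short(type="coalgType")]
HB.structure Definition Coalgebra (K : comNzRingType) :=
  {C of GRing.Lmodule K C & Lmodule_isCoalgebra K C}.

HB.instance Definition _ (K : comNzRingType) (C : coalgType K) :=
  GRing.isLinear.Build K C (C ⊗ C)%type *:%R (@comul K C) comul_linear.
HB.instance Definition _ (K : comNzRingType) (C : coalgType K) :=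
  GRing.isLinear.Build K C K *%R (@counit K C) counit_scalar.

HB.mixin Record Algebra_Coalgebra_isHopf (K : comNzRingType) H
    of GRing.Algebra K H & Coalgebra K H := {
  comulM : forall x y : H, comul (x * y) = tensor_mul (comul x) (comul y);
  comul1 : comul (1 : H) = 1 ⊗ 1;
  counitM : forall x y : H, counit (x * y) = counit x * counit y;
  counit1 : counit (1 : H) = 1;
  antipode : H -> H;
  antipode_linear : linear antipode;
  antipodel : forall x : H,
    tensor_lift (fun x1 x2 => antipode x1 * x2) (comul x) = (counit x)%:A;
  antipoder : forall x : H,
    tensor_lift (fun x1 x2 => x1 * antipode x2) (comul x) = (counit x)%:A
}.

#[short(type="hopfAlgType")]
HB.structure Definition HopfAlgebra (K : comNzRingType) :=
  {H of GRing.Algebra K H & Coalgebra K H & Algebra_Coalgebra_isHopf K H}.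

HB.instance Definition _ (K : comNzRingType) (H : hopfAlgType K) :=
  GRing.isLinear.Build K H H *:%R (@antipode K H) antipode_linear.

Record rcomodule (K : comNzRingType) (H : coalgType K) (V : lmodType K) := {
  coact :> {linear V -> (V ⊗ H)%type};
  coact_assoc : forall v,
    tensor_assoc (tensor_map coact idfun (coact v)) =
    tensor_map idfun comul (coact v);
  coact_counit : forall v,
    tensor_lift (fun v0 v1 => counit v1 *: v0) (coact v) = v
}.

Section Subcoalgebras.
Variables (K : comNzRingType) (C : coalgType K).
Implicit Types D E : {pred C}.

Definition subcoalgebra D : Prop :=
  submod_closed D /\
  forall c, c \in D -> exists s : seq (C * C),
    {in s, forall p, p.1 \in D /\ p.2 \in D} /\
    comul c = \sum_(p <- s) p.1 ⊗ p.2.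

Definition simple_subcoalgebra D : Prop :=
  [/\ subcoalgebra D, ~ D =i pred1 0
    & forall E, subcoalgebra E -> {subset E <= D} -> E =i pred1 0 \/ E =i D].

End Subcoalgebras.

HB.mixin Record Coalgebra_hasCirc (C : numClosedFieldType) A
    of Coalgebra C A := {
  circ : A -> A;
  circ_conj_linear : linear_for (conjC \; *:%R) circ;
  circK : involutive circ;
  comul_circ : forall c : A,
    comul (circ c) = tensor_lift (fun c1 c2 => circ c2 ⊗ circ c1) (comul c)
}.

#[short(type="circCoalgType")]
HB.structure Definition CircCoalgebra (C : numClosedFieldType) :=
  {A of Coalgebra C A & Coalgebra_hasCirc C A}.

HB.mixin Record HopfAlgebra_CircCoalgebra_isCircHopf (C : numClosedFieldType) H
    of HopfAlgebra C H & CircCoalgebra C H := {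
  circM : forall x y : H, circ (x * y) = circ x * circ y
}.

#[short(type="circHopfAlgType")]
HB.structure Definition CircHopfAlgebra (C : numClosedFieldType) :=
  {H of HopfAlgebra C H & CircCoalgebra C H &
        HopfAlgebra_CircCoalgebra_isCircHopf C H}.

Section CompactQuantumGroup.
Variables (C : numClosedFieldType) (H : circHopfAlgType C).

(* Forms in {dot V for conjC} are linear in the first variable and            *)
(* conjugate linear in the second one.                                        *)
Definition unitary (V : lmodType C) (delta : rcomodule H V)
    (f : {dot V for conjC}) : Prop :=
  forall u v : V,
    tensor_lift (fun u0 u1 => f u0 v *: u1) (delta u) =
    tensor_lift (fun v0 v1 => f u v0 *: circ v1) (delta v).

Definition compact_quantum_group : Prop :=
  forall (V : lmodType C) (delta : rcomodule H V),
    exists f : {dot V for conjC}, unitary delta f.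

(* The set of all a%:A is C1, so this is the sum of the simple subcoalgebras  *)
(* other than C1.                                                             *)
Definition in_other_simples (x : H) : Prop :=
  exists s : seq H, x = \sum_(y <- s) y /\
    {in s, forall y, exists D : {pred H},
      [/\ simple_subcoalgebra D,
          ~ (forall z, z \in D <-> exists a : C, z = a%:A) & y \in D]}.

(* phi is the projection onto C1, identified with C, whose kernel is the sum  *)
(* of the other simple subcoalgebras.                                         *)
Definition normal_integral (phi : {scalar H}) : Prop :=
  phi 1 = 1 /\ forall x, phi x = 0 <-> in_other_simples x.

Definition integral_form (phi : {scalar H}) (x y : H) : C :=
  phi (antipode (circ y) * x).

End CompactQuantumGroup.

(* Main.v *)
Require Import Defs.
From HB Require Import structures.
From mathcomp Require Import all_boot all_order all_algebra.
From mathcomp Require Import sesquilinear complex boolp reals ring.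

Set Implicit Arguments.
Unset Strict Implicit.
Unset Printing Implicit Defensive.

Import Order.TTheory GRing.Theory Num.Theory Num.Def.
Local Open Scope ring_scope.

(* Unitary inner products on the comodules H (coaction Delta) and H (coaction *)
(* x |-> x_2 ⊗ S^-1(x_1)) give positive definite forms f and g, the first one *)
(* invariant on the right and the second one on the left. The convolution     *)
(* b(x, y) = g(x_1, y_1) f(x_2, y_2) is again positive definite, being the    *)
(* restriction of g ⊗ f along Delta. The form h(x, y) = phi(S(y°) x) is right *)
(* invariant, and it is a left unit for left invariant forms, so that         *)
(* h * b = b. Given x, take a finite dimensional right subcomodule D of H     *)
(* containing x, and w in D with b(w, y) = h(x, y) for all y in D. Right      *)
(* invariance of b and h yields (b * b)(w, y) = (h * b)(x, y) = b(x, y), so   *)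
(* that h(x, x) = b(w, x) is the conjugate of (b * b)(w, w), which is         *)
(* positive. Polarization then shows that h is hermitian.                     *)

(** * Sweedler notation *)

(** The hypotheses provide inner products on comodules but no direct information on the sign of
    [phi], so h(x, y) = [integral_form phi x y] is compared with an inner product b = g * f, where f
    is right invariant and g is left invariant. On a finite dimensional subcomodule containing x
    ([finite_subcomodule]), let w represent h(x, -) with respect to b ([riesz_spanned]). Since b and
    h are both right invariant, w can replace x under the comultiplication, whence (b * b)(w, y) =
    (h * b)(x, y) = b(x, y). Thus h is to b what b is to b * b, and applying the correspondence
    twice gives h(x, x) as the conjugate of (b * b)(w, w). Positivity of b and b * b is
    [inner_product_convolution]. The identity h * b = b follows from h * g = g
    ([convolution_integral]) and [convolutionA]. Right invariance comes from
    [right_invariant_convolution] for b and from [right_invariant_integral] for h. *)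

Definition bilin (K : comNzRingType) (V W U : lmodType K) (f : V -> W -> U) :=
  (forall w, linear (f^~ w)) /\ (forall v, linear (f v)).

Definition sweedler (K : comNzRingType) (C : coalgType K) (U : lmodType K)
    (f : C -> C -> U) (x : C) : U :=
  tensor_lift f (comul x).

Section Linear.
Variables (K : comNzRingType) (V W : lmodType K).

Lemma linear_add (f : V -> W) : linear f -> {morph f : x y / x + y}.
Proof. by move=> lf x y; have := lf 1 x y; rewrite !scale1r. Qed.

Lemma linear_zero (f : V -> W) : linear f -> f 0 = 0.
Proof. by move=> lf; apply: (addIr (f 0)); rewrite -linear_add// !add0r. Qed.

Lemma linear_scale (f : V -> W) : linear f -> forall a x, f (a *: x) = a *: f x.
Proof. by move=> lf a x; have := lf a x 0; rewrite linear_zero// !addr0. Qed.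

Lemma linear_bigsum (f : V -> W) I (s : seq I) (F : I -> V) : linear f ->
  f (\sum_(i <- s) F i) = \sum_(i <- s) f (F i).
Proof.
by move=> lf; apply: (big_morph f (linear_add lf) (linear_zero lf)).
Qed.

End Linear.

Section Bilinear.
Variables (K : comNzRingType) (V W U : lmodType K).

Lemma bilin_balanced (f : V -> W -> U) : bilin f -> balanced f.
Proof.
move=> [fl fr]; split=> [v v' w|v w w'|a v w].
- exact: (linear_add (fl w) v v').
- exact: (linear_add (fr v) w w').
- by rewrite (linear_scale (fl w)) (linear_scale (fr v)).
Qed.

Lemma tensor_lift_linear (f : V -> W -> U) : bilin f -> linear (tensor_lift f).
Proof.
move=> bf a s t; rewrite tensor_liftD ?tensor_liftZ//; first exact: bilin_balanced.
by move=> v w; rewrite (linear_scale (bf.1 w)).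
exact: bilin_balanced.
Qed.

Lemma bilin_tensor : bilin (@tensor_pure K V W).
Proof.
have [Dl Dr Z] := tensor_pure_balanced V W.
by split=> [w|v] a x y /=; rewrite ?Dl ?Dr -?Z tensor_scale_pure.
Qed.

Lemma tensor_lift_sum (f : V -> W -> U) (s : seq (V * W)) : bilin f ->
  tensor_lift f (\sum_(p <- s) p.1 ⊗ p.2) = \sum_(p <- s) f p.1 p.2.
Proof.
move=> bf; rewrite (linear_bigsum _ _ (tensor_lift_linear bf)).
by apply: eq_bigr => p _; rewrite tensor_lift_pure//; exact: bilin_balanced.
Qed.

Lemma tensor_repr (t : V ⊗ W) : t = \sum_(p <- generic_quotient.repr t) p.1 ⊗ p.2.
Proof.
rewrite -[LHS]generic_quotient.reprK.
elim: (generic_quotient.repr t) => [|[v w] s IH]; first by rewrite big_nil.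
by rewrite big_cons -IH tensor_piD.
Qed.

Lemma linear_id : linear (fun x : V => x). Proof. by []. Qed.

Lemma linear_scalel (s : V -> K^o) (u : U) : linear s -> linear (fun x => s x *: u).
Proof. by move=> ls a x y; rewrite ls scalerDl -scalerA. Qed.

Lemma linear_scaler (k : K) (t : V -> U) : linear t -> linear (fun x => k *: t x).
Proof. by move=> lt a x y; rewrite lt scalerDr !scalerA mulrC. Qed.

Lemma linear_sumf (I : Type) (r : seq I) (F : I -> V -> U) :
  (forall i, linear (F i)) -> linear (fun x => \sum_(i <- r) F i x).
Proof.
move=> lF a x y; rewrite scaler_sumr -big_split.
by apply: eq_bigr => i _; rewrite lF.
Qed.

End Bilinear.

Lemma linear_comp (K : comNzRingType) (V W U : lmodType K) (f : W -> U) (g : V -> W) :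
  linear f -> linear g -> linear (fun x => f (g x)).
Proof. by move=> lf lg a x y; rewrite lg lf. Qed.

Lemma linear_bil (K : comNzRingType) (V W W' U : lmodType K)
    (f : W -> W' -> U) (g : V -> W) w :
  bilin f -> linear g -> linear (fun x => f (g x) w).
Proof. by move=> bf lg a x y; rewrite lg (bf.1 w). Qed.

Lemma linear_bir (K : comNzRingType) (V W W' U : lmodType K)
    (f : W -> W' -> U) (g : V -> W') w :
  bilin f -> linear g -> linear (fun x => f w (g x)).
Proof. by move=> bf lg a x y; rewrite lg (bf.2 w). Qed.

(* Unification does not recover K^o as the codomain of the general versions.  *)
Section LinearScalar.
Variables (K : comNzRingType) (V W W' : lmodType K).

Lemma linear_compo (f : W -> K^o) (g : V -> W) :
  linear f -> linear g -> linear (fun x => f (g x)).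
Proof. exact: linear_comp. Qed.

Lemma linear_bilo (f : W -> W' -> K^o) (g : V -> W) w :
  bilin f -> linear g -> linear (fun x => f (g x) w).
Proof. exact: linear_bil. Qed.

Lemma linear_biro (f : W -> W' -> K^o) (g : V -> W') w :
  bilin f -> linear g -> linear (fun x => f w (g x)).
Proof. exact: linear_bir. Qed.

Lemma linear_scalero (k : K) (f : V -> K^o) : linear f -> linear (fun x => k *: f x).
Proof. exact: linear_scaler. Qed.

End LinearScalar.

Section LinearAlg.
Variables (K : comNzRingType) (V : lmodType K) (A : algType K).

Lemma linear_mull (f : V -> A) (b : A) : linear f -> linear (fun x => f x * b).
Proof. by move=> lf a x y; rewrite lf mulrDl scalerAl. Qed.

Lemma linear_mulr (f : V -> A) (b : A) : linear f -> linear (fun x => b * f x).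
Proof. by move=> lf a x y; rewrite lf mulrDr scalerAr. Qed.

End LinearAlg.

Section Sweedler.
Variables (K : comNzRingType) (C : coalgType K) (U : lmodType K).

Lemma sweedler_sum (f : C -> C -> U) x (s : seq (C * C)) : bilin f ->
  comul x = \sum_(p <- s) p.1 ⊗ p.2 ->
  sweedler f x = \sum_(p <- s) f p.1 p.2.
Proof. by move=> bf; rewrite /sweedler => ->; rewrite tensor_lift_sum. Qed.

Lemma eq_sweedler (f g : C -> C -> U) x : (forall a b, f a b = g a b) ->
  sweedler f x = sweedler g x.
Proof. by move=> fg; apply: eq_bigr => p _; rewrite fg. Qed.

Lemma linear_sweedler (V : lmodType K) (f : C -> C -> V -> U) x :
  (forall a b, linear (f a b)) -> linear (fun v => sweedler (fun a b => f a b v) x).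
Proof. by move=> lf; apply: linear_sumf => p; exact: lf. Qed.

Lemma linear_sweedlerr (V : lmodType K) (f : C -> C -> U) (g : V -> C) :
  bilin f -> linear g -> linear (fun v => sweedler f (g v)).
Proof.
move=> bf lg; apply: linear_comp (tensor_lift_linear bf) _.
by move=> a x y; rewrite lg linearP.
Qed.

Lemma sweedler_linear (V W : lmodType K) (g : V -> W) (f : C -> C -> V) x :
  linear g -> g (sweedler f x) = sweedler (fun a b => g (f a b)) x.
Proof. exact: linear_bigsum. Qed.

(** [sweedler] is a finite sum over the chosen representative of [comul], so this is an exchange of
    two finite sums. Bilinearity comes in when the representative changes, as in [sweedler_sum]. *)
Lemma sweedlerC (D : coalgType K) (f : C -> C -> D -> D -> U) x y :
  sweedler (fun a b => sweedler (f a b) y) x =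
  sweedler (fun c d => sweedler (fun a b => f a b c d) x) y.
Proof. exact: exchange_big. Qed.

Lemma sweedler_counitl (f : C -> U) x : linear f ->
  sweedler (fun a b => counit a *: f b) x = f x.
Proof.
move=> lf; rewrite -[in RHS](counitl x) (sweedler_linear _ _ lf).
by apply: eq_sweedler => a b; rewrite (linear_scale lf).
Qed.

Lemma sweedler_counitr (f : C -> U) x : linear f ->
  sweedler (fun a b => counit b *: f a) x = f x.
Proof.
move=> lf; rewrite -[in RHS](counitr x) (sweedler_linear _ _ lf).
by apply: eq_sweedler => a b; rewrite (linear_scale lf).
Qed.

Definition trilin (F : C -> C -> C -> U) :=
  [/\ forall b c, linear (fun a => F a b c), forall a c, linear (fun b => F a b c)
    & forall a b, linear (F a b)].

(** This is [coassoc] tested against [F]: a trilinear map factors through the triple tensor product,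
    and the induced linear map is applied to both sides. *)
Lemma sweedlerA (F : C -> C -> C -> U) x : trilin F ->
  sweedler (fun a b => sweedler (fun c d => F c d b) a) x =
  sweedler (fun a b => sweedler (F a) b) x.
Proof.
move=> [F1 F2 F3].
have bF a : bilin (F a) by split=> [c|b]; [exact: F2|exact: F3].
have bF' c : bilin (fun a b => F a b c) by split=> [b|a]; [exact: F1|exact: F2].
have bG : bilin (fun a (t : C ⊗ C) => tensor_lift (F a) t).
  split=> [t|a]; last exact: tensor_lift_linear.
  by apply: linear_sumf => p; exact: F1.
have bA : bilin (fun (t : C ⊗ C) (c : C) => tensor_lift (fun a b => a ⊗ (b ⊗ c)) t).
  split=> [c|t].
    apply: tensor_lift_linear; split=> [b|a].
      exact: (bilin_tensor _ _).1.
    by apply: linear_comp ((bilin_tensor _ _).2 _) ((bilin_tensor _ _).1 _).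
  apply: linear_sumf => p.
  by apply: linear_comp ((bilin_tensor _ _).2 _) ((bilin_tensor _ _).2 _).
have bM1 : bilin (fun v w : C => comul v ⊗ @idfun C w).
  split=> [w|v]; last exact: (bilin_tensor _ _).2.
  exact: linear_comp ((bilin_tensor _ _).1 _) (@linearP _ _ _ _ comul).
have bM2 : bilin (fun v w : C => @idfun C v ⊗ comul w).
  split=> [w|v]; first exact: (bilin_tensor _ _).1.
  exact: linear_comp ((bilin_tensor _ _).2 _) (@linearP _ _ _ _ comul).
set s := generic_quotient.repr (comul x).
have E1 : tensor_assoc (tensor_map comul idfun (comul x)) =
    \sum_(p <- s) tensor_lift (fun a b => a ⊗ (b ⊗ p.2)) (comul p.1).
  rewrite [X in tensor_map _ _ X](tensor_repr (comul x)) -/s.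
  rewrite [tensor_map _ _ _](tensor_lift_sum _ bM1).
  rewrite [LHS](linear_bigsum _ _ (tensor_lift_linear bA)).
  by apply: eq_bigr => p _; rewrite tensor_lift_pure//; exact: bilin_balanced.
have E2 : tensor_map idfun comul (comul x) = \sum_(p <- s) p.1 ⊗ comul p.2.
  rewrite [X in tensor_map _ _ X](tensor_repr (comul x)) -/s.
  exact: (tensor_lift_sum _ bM2).
have lG := tensor_lift_linear bG.
have /(congr1 (tensor_lift (fun a t => tensor_lift (F a) t))) := coassoc x.
rewrite E1 E2 !(linear_bigsum _ _ lG) => E.
transitivity (\sum_(p <- s) sweedler (fun a b => F a b p.2) p.1).
  by [].
transitivity (\sum_(p <- s) tensor_lift (fun a t => tensor_lift (F a) t)
    (tensor_lift (fun a b : C => a ⊗ (b ⊗ p.2)) (comul p.1))).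
  apply: eq_bigr => p _; rewrite [in RHS](linear_bigsum _ _ lG).
  apply: eq_bigr => q _.
  by rewrite !tensor_lift_pure//; exact: bilin_balanced.
rewrite E; apply: eq_bigr => p _.
by rewrite tensor_lift_pure//; exact: bilin_balanced.
Qed.

End Sweedler.

(* Each bilinear map that occurs in the goal without being one of the listed  *)
(* constants must have its bilinearity among the hypotheses.                  *)
Ltac lin := cbn beta; lazymatch goal with
  | |- bilin _ => split; intro; lin
  | |- trilin _ => split; intros ? ?; lin
  | |- _ => solve
    [ assumption
    | exact: linear_id
    | exact: linearP
    | match goal with
      | |- GRing.linear_for _ (fun x => @sweedler _ _ _ (fun a b => @?f a b x) ?y) =>
          apply: (@linear_sweedler _ _ _ _ f y); intros ? ?; lin
      | |- GRing.linear_for _ (fun x => @sweedler _ _ _ ?f (@?g x)) =>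
          apply: (@linear_sweedlerr _ _ _ _ f g); lin
      | |- GRing.linear_for _ (fun x => @?f x *: ?u) =>
          apply: (@linear_scalel _ _ _ f u); lin
      | |- GRing.linear_for _ (fun x => ?k *: @?f x) =>
          first [ apply: (@linear_scaler _ _ _ k f)
                | apply: (@linear_scalero _ _ k f) ]; lin
      | |- GRing.linear_for _ (fun x => @?f x ⊗ ?u) =>
          apply: (@linear_bil _ _ _ _ _ _ f u (bilin_tensor _ _)); lin
      | |- GRing.linear_for _ (fun x => ?u ⊗ @?f x) =>
          apply: (@linear_bir _ _ _ _ _ _ f u (bilin_tensor _ _)); lin
      | |- GRing.linear_for _ (fun x => @?f x * ?u) =>
          apply: (@linear_mull _ _ _ f u); lin
      | |- GRing.linear_for _ (fun x => ?u * @?f x) =>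
          apply: (@linear_mulr _ _ _ f u); lin
      | H : bilin ?p |- GRing.linear_for _ (fun x => ?p (@?f x) ?u) =>
          first [ apply: (@linear_bil _ _ _ _ _ p f u H)
                | apply: (@linear_bilo _ _ _ _ p f u H) ]; lin
      | H : bilin ?p |- GRing.linear_for _ (fun x => ?p ?u (@?f x)) =>
          first [ apply: (@linear_bir _ _ _ _ _ p f u H)
                | apply: (@linear_biro _ _ _ _ p f u H) ]; lin
      | H : bilin ?p |- GRing.linear_for _ (?p ?u) => exact: (proj2 H u)
      | |- GRing.linear_for _ (tensor_pure ?u) => exact: (proj2 (bilin_tensor _ _) u)
      | H : GRing.linear_for _ ?p |- GRing.linear_for _ (fun x => ?p (@?f x)) =>
          first [ apply: (@linear_comp _ _ _ _ p f H)
                | apply: (@linear_compo _ _ _ p f H) ]; lin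
      | |- GRing.linear_for _ (fun x => comul (@?f x)) =>
          apply: (@linear_comp _ _ _ _ comul f comul_linear); lin
      | |- GRing.linear_for _ (fun x => antipode (@?f x)) =>
          apply: (@linear_comp _ _ _ _ antipode f antipode_linear); lin
      | |- GRing.linear_for _ (fun x => counit (@?f x)) =>
          apply: (@linear_compo _ _ _ counit f counit_scalar); lin
      end ]
  end.

(** * The algebra [A ⊗ A] and the coproduct of the antipode *)

Section TensorMul.
Variables (K : comNzRingType) (A : algType K).

Lemma bilin_tensor_mul : bilin (@tensor_mul K A A).
Proof.
have b1 (a b : A) : bilin (fun c d => (a * c) ⊗ (b * d)) by lin.
split=> [t|s].
  apply: tensor_lift_linear; split=> [b|a]; apply: linear_sumf => p; lin.
apply: linear_sumf => p; exact: tensor_lift_linear.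
Qed.

Lemma tensor_ind (V W : lmodType K) (P : V ⊗ W -> Prop) :
  P 0 -> (forall v w t, P t -> P (v ⊗ w + t)) -> forall t, P t.
Proof.
move=> P0 PD t; rewrite [t]tensor_repr.
by elim: (generic_quotient.repr _) => [|p s IH]; rewrite ?big_nil// big_cons; apply: PD.
Qed.

Lemma eq_linear_tensor (V W U : lmodType K) (f g : V ⊗ W -> U) :
  linear f -> linear g -> (forall v w, f (v ⊗ w) = g (v ⊗ w)) -> f =1 g.
Proof.
move=> lf lg fg; elim/tensor_ind => [|v w t IH].
  by rewrite (linear_zero lf) (linear_zero lg).
by rewrite (linear_add lf) (linear_add lg) IH fg.
Qed.

Lemma tensor_mulA (r s t : A ⊗ A) :
  tensor_mul r (tensor_mul s t) = tensor_mul (tensor_mul r s) t.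
Proof.
have bM := bilin_tensor_mul.
move: r; apply: eq_linear_tensor; [lin|lin|move=> a b].
move: s; apply: eq_linear_tensor; [lin|lin|move=> c d].
move: t; apply: eq_linear_tensor; [lin|lin|move=> e f].
by rewrite !tensor_mul_pure !mulrA.
Qed.

Lemma tensor_mul1 (s : A ⊗ A) : tensor_mul (1 ⊗ 1) s = s.
Proof.
have bM := bilin_tensor_mul.
move: s; apply: eq_linear_tensor; [lin|lin|move=> c d].
by rewrite tensor_mul_pure !mul1r.
Qed.

Lemma tensor_mulr1 (s : A ⊗ A) : tensor_mul s (1 ⊗ 1) = s.
Proof.
have bM := bilin_tensor_mul.
move: s; apply: eq_linear_tensor; [lin|lin|move=> c d].
by rewrite tensor_mul_pure !mulr1.
Qed.

End TensorMul.

Section Antipode.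
Variables (K : comNzRingType) (H : hopfAlgType K).
Implicit Types x y : H.

Lemma sweedler_antipodel x :
  sweedler (fun a b => antipode a * b) x = (counit x)%:A.
Proof. exact: antipodel. Qed.

Lemma sweedler_antipoder x :
  sweedler (fun a b => a * antipode b) x = (counit x)%:A.
Proof. exact: antipoder. Qed.

(* Both sides are convolution inverses of comul in Hom(H, H ⊗ H). *)
Lemma comul_antipode_sweedler x :
  comul (antipode x) = sweedler (fun a b => antipode b ⊗ antipode a) x.
Proof.
have bM := bilin_tensor_mul H.
pose Q x := sweedler (fun a b : H => antipode b ⊗ antipode a) x.
have bQ : bilin (fun a b : H => antipode b ⊗ antipode a) by lin.
have lQ : linear Q by rewrite /Q; lin.
(* [comul] after [antipode] is a left convolution inverse of [comul], because [comul] is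
   multiplicative. *)
have PD y : sweedler (fun a b => tensor_mul (comul (antipode a)) (comul b)) y
    = counit y *: (1 ⊗ 1).
  transitivity (comul (sweedler (fun a b => antipode a * b) y)).
    rewrite (sweedler_linear _ _ comul_linear).
    by apply: eq_sweedler => a b; rewrite comulM.
  by rewrite sweedler_antipodel (linear_scale comul_linear) comul1.
(* [Q] is a right convolution inverse of [comul]: in y_1 S(y_4) ⊗ y_2 S(y_3) the inner pair cancels
   first, then the outer one. *)
have DQ y : sweedler (fun a b => tensor_mul (comul a) (Q b)) y
    = counit y *: (1 ⊗ 1).
  transitivity (sweedler (fun a b => sweedler (fun c d =>
      sweedler (fun e f => (c * antipode f) ⊗ (d * antipode e)) b) a) y).
    apply: eq_sweedler => a b.
    rewrite /Q (sweedler_linear _ _ (bM.2 _)) /= sweedlerC.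
    apply: eq_sweedler => e f.
    have lM : linear (fun t => tensor_mul t (antipode f ⊗ antipode e)) by lin.
    rewrite [comul a]tensor_repr (linear_bigsum _ _ lM).
    by apply: eq_bigr => p _; rewrite tensor_mul_pure.
  rewrite sweedlerA; last by lin.
  transitivity (sweedler (fun a b => (a * antipode b) ⊗ (1 : H)) y).
    apply: eq_sweedler => a b.
    rewrite -(sweedlerA (F := fun c d e => (a * antipode e) ⊗ (c * antipode d))); last by lin.
    transitivity (sweedler (fun c d => counit c *: ((a * antipode d) ⊗ (1 : H))) b).
      apply: eq_sweedler => c d.
      rewrite -(sweedler_linear _ _ ((bilin_tensor _ _).2 (a * antipode d))) /=.
      by rewrite sweedler_antipoder (linear_scale ((bilin_tensor _ _).2 _)).
    by rewrite (sweedler_counitl (f := fun d => (a * antipode d) ⊗ (1 : H)))//; lin.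
  rewrite -(sweedler_linear _ _ ((bilin_tensor _ _).1 (1 : H))) /=.
  by rewrite sweedler_antipoder tensor_scale_pure.
have lP : linear (fun y : H => comul (antipode y)) by lin.
(* A left and a right inverse agree: insert [comul] convolved with [Q], reassociate, and cancel on
   the left. *)
rewrite -[LHS](sweedler_counitr x lP).
transitivity (sweedler (fun a b => sweedler (fun c d =>
  tensor_mul (comul (antipode a)) (tensor_mul (comul c) (Q d))) b) x).
  apply: eq_sweedler => a b.
  rewrite -(sweedler_linear _ _ (bM.2 _)) DQ (linear_scale (bM.2 _)).
  by rewrite tensor_mulr1.
rewrite -sweedlerA; last by lin.
rewrite -[RHS](sweedler_counitl x lQ); apply: eq_sweedler => a b.
transitivity (sweedler (fun c d => tensor_mul
  (tensor_mul (comul (antipode c)) (comul d)) (Q b)) a).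
  by apply: eq_sweedler => c d; rewrite tensor_mulA.
rewrite -(sweedler_linear _ _ (bM.1 _)) PD (linear_scale (bM.1 _)).
by rewrite tensor_mul1.
Qed.

End Antipode.

(** * The antipode and the involution *)

(** Variant of [tensor_lift_sum] for maps that are only balanced, such as those that are conjugate
    linear in both legs because of [circ]. *)
Lemma tensor_lift_balanced (K : comNzRingType) (V W : lmodType K) (U : zmodType)
    (f : V -> W -> U) I (s : seq I) (F : I -> V) (G : I -> W) : balanced f ->
  tensor_lift f (\sum_(i <- s) F i ⊗ G i) = \sum_(i <- s) f (F i) (G i).
Proof.
move=> bf; rewrite (big_morph _ (tensor_liftD bf) (id1 := 0)).
  by apply: eq_bigr => i _; rewrite tensor_lift_pure.
by apply: (addIr (tensor_lift f 0)); rewrite -tensor_liftD// !add0r.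
Qed.

Lemma comul_antipode_sum (K : comNzRingType) (H : hopfAlgType K)
    I (s : seq I) (F G : I -> H) x :
  comul x = \sum_(i <- s) F i ⊗ G i ->
  comul (antipode x) = \sum_(i <- s) antipode (G i) ⊗ antipode (F i).
Proof.
move=> xE; rewrite comul_antipode_sweedler /sweedler xE tensor_lift_balanced//.
by apply: bilin_balanced; lin.
Qed.

Lemma sweedler_antipode (K : comNzRingType) (H : hopfAlgType K) (U : lmodType K)
    (f : H -> H -> U) x : bilin f ->
  sweedler f (antipode x) = sweedler (fun a b => f (antipode b) (antipode a)) x.
Proof.
move=> bf; rewrite /sweedler (comul_antipode_sum (tensor_repr (comul x))).
by rewrite tensor_lift_balanced//; exact: bilin_balanced.
Qed.

Lemma counit_linear (K : comNzRingType) (C : coalgType K) :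
  linear (counit : C -> K^o).
Proof. exact: counit_scalar. Qed.

Section CircCoalgebra.
Variables (K : numClosedFieldType) (C : circCoalgType K).
Implicit Types x y : C.

Lemma circD : {morph (@circ K C) : x y / x + y}.
Proof.
by move=> x y; have /= := circ_conj_linear 1 x y; rewrite conjC1 !scale1r.
Qed.

Lemma circ0 : circ (0 : C) = 0.
Proof. by apply: (addIr (circ 0)); rewrite -circD !add0r. Qed.

Lemma circZ a x : circ (a *: x) = a^* *: circ x.
Proof. by have /= := circ_conj_linear a x 0; rewrite circ0 !addr0. Qed.

Lemma circ_sum I (s : seq I) (F : I -> C) :
  circ (\sum_(i <- s) F i) = \sum_(i <- s) circ (F i).
Proof. exact: (big_morph _ circD circ0). Qed.

Lemma balanced_circ : balanced (fun a b : C => circ b ⊗ circ a).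
Proof.
have [Dl Dr Z] := tensor_pure_balanced C C.
by split=> [v v' w|v w w'|a v w]; rewrite ?circD ?circZ ?Dl ?Dr ?Z.
Qed.

Lemma comul_circ_sum I (s : seq I) (F G : I -> C) x :
  comul x = \sum_(i <- s) F i ⊗ G i ->
  comul (circ x) = \sum_(i <- s) circ (G i) ⊗ circ (F i).
Proof.
by move=> xE; rewrite comul_circ xE tensor_lift_balanced//; exact: balanced_circ.
Qed.

Lemma sweedler_circ (U : lmodType K) (f : C -> C -> U) x : bilin f ->
  sweedler f (circ x) = sweedler (fun a b => f (circ b) (circ a)) x.
Proof.
move=> bf; rewrite /sweedler (comul_circ_sum (tensor_repr (comul x))).
by rewrite tensor_lift_balanced//; exact: bilin_balanced.
Qed.

(** Uniqueness of the counit: applying [circ] to the right counit law at [circ x] shows that the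
    conjugate of [counit (circ x)] obeys the left counit law. *)
Lemma counit_circ x : counit (circ x) = (counit x)^*.
Proof.
pose e y : K^o := (counit (circ y))^*.
have le : linear e.
  move=> a y z; rewrite /e circD circZ (linear_add (@counit_linear K C)).
  by rewrite (linear_scale (@counit_linear K C)) rmorphD rmorphM /= conjCK.
have ex : sweedler (fun a b => e a *: b) x = x.
  rewrite -[RHS]circK -[LHS]circK; congr (circ _).
  rewrite -[RHS](counitr (circ x)) -[RHS]/(sweedler _ _).
  rewrite sweedler_circ; last by lin.
  by rewrite /sweedler /tensor_lift circ_sum; apply: eq_bigr => p _; rewrite circZ conjCK.
rewrite -[LHS]conjCK -[in RHS]ex; congr (_^*).
rewrite -[LHS](sweedler_counitr _ le).
rewrite (sweedler_linear _ _ (@counit_linear K C)).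
apply: eq_bigr => -[a b] _ /=.
rewrite (linear_scale (@counit_linear K C)); exact: mulrC.
Qed.

End CircCoalgebra.

Section CircHopf.
Variables (K : numClosedFieldType) (H : circHopfAlgType K).
Implicit Types x y : H.

Lemma circ1 : circ (1 : H) = 1.
Proof. by rewrite -[circ 1]mulr1 -[X in _ * X]circK -circM mul1r circK. Qed.

(* The inverse of the antipode. *)
Definition skew_antipode x : H := circ (antipode (circ x)).

Lemma skew_antipode_linear : linear skew_antipode.
Proof.
move=> a x y; rewrite /skew_antipode circD circZ antipode_linear circD circZ.
by rewrite conjCK.
Qed.

(** Three order-reversing maps [circ], [antipode], [circ] compose to an order-reversing one. *)
Lemma sweedler_skew_antipode (U : lmodType K) (f : H -> H -> U) x : bilin f ->
  sweedler f (skew_antipode x) =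
  sweedler (fun a b => f (skew_antipode b) (skew_antipode a)) x.
Proof.
move=> bf; have := comul_circ_sum (tensor_repr (comul x)).
move=> /comul_antipode_sum/comul_circ_sum xE.
by rewrite /sweedler xE tensor_lift_balanced//; exact: bilin_balanced.
Qed.

(** Image under [circ] of the left antipode law at [circ x]; the legs are swapped, as befits an
    inverse of the antipode. *)
Lemma skew_antipodel x : sweedler (fun a b => skew_antipode b * a) x = (counit x)%:A.
Proof.
rewrite -[LHS]circK.
have -> : circ (sweedler (fun a b => skew_antipode b * a) x) = (counit (circ x))%:A.
  rewrite -sweedler_antipodel sweedler_circ; last by lin.
  rewrite /sweedler /tensor_lift circ_sum; apply: eq_bigr => p _.
  by rewrite circM circK.
by rewrite circZ counit_circ conjCK circ1.
Qed.

End CircHopf.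

(** * Invariant inner products *)

Lemma counit_antipode (K : comNzRingType) (H : hopfAlgType K) (x : H) :
  counit (antipode x) = counit x.
Proof.
have lc := @counit_linear K H.
have l1 : linear (fun y : H => counit (antipode y) : K^o) by lin.
have := congr1 (counit : H -> K^o) (sweedler_antipodel x).
rewrite (linear_scale lc) counit1 /= => E.
rewrite -[LHS](sweedler_counitr x l1).
apply: etrans (etrans _ E) _; last exact: mulr1.
rewrite (sweedler_linear _ _ lc); apply: eq_bigr => -[a b] _ /=.
by rewrite counitM; exact: mulrC.
Qed.

Section Forms.
Variables (K : numClosedFieldType) (H : circHopfAlgType K).
Implicit Types (x y u v : H) (p q : H -> H -> K^o).

(* A bilinear form p stands for the sesquilinear form (x, y) |-> p x (circ y).  *)
(* Since comul (circ y) = \sum circ y_2 ⊗ circ y_1, the legs of the second     *)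
(* argument appear below in the opposite order.                               *)
Definition inner_product p :=
  [/\ bilin p, forall x y, p x (circ y) = (p y (circ x))^*
    & forall x, x != 0 -> 0 < p x (circ x)].

Definition right_invariant p := forall x v,
  sweedler (fun x1 x2 => p x1 v *: x2) x = sweedler (fun v1 v2 => p x v2 *: v1) v.

(** Unitarity for the coaction x ↦ x_2 ⊗ S^-1(x_1). On the right-hand side [circ] has turned S^-1
    into [antipode]. *)
Definition left_invariant p := forall x v,
  sweedler (fun x1 x2 => p x2 v *: skew_antipode x1) x =
  sweedler (fun v1 v2 => p x v1 *: antipode v2) v.

Definition convolution p q x v : K^o :=
  sweedler (fun x1 x2 => sweedler (fun v1 v2 => p x1 v2 *: q x2 v1) v) x.

Lemma bilin_convolution p q : bilin p -> bilin q -> bilin (convolution p q).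
Proof. by move=> bp bq; rewrite /convolution; lin. Qed.

Lemma comodule_inner_product (delta : rcomodule H H) : compact_quantum_group H ->
  exists2 p, inner_product p & forall x y,
    tensor_lift (fun u0 u1 => p u0 (circ y) *: u1) (delta x) =
    tensor_lift (fun v0 v1 => p x (circ v0) *: circ v1) (delta y).
Proof.
move=> /(_ _ delta) [f fE]; exists (fun x v => f x (circ v)).
  split.
  - split=> [v|u] a x y /=; first by rewrite linearPl.
    by rewrite circD circZ linearPr /= conjCK.
  - move=> x y; rewrite !circK.
    by rewrite hermC expr0 mul1r.
  - by move=> x x0; rewrite circK; apply: neq0_dnorm_gt0.
move=> x y; rewrite circK fE; apply: eq_bigr => p _; by rewrite circK.
Qed.

Definition regular_comodule : rcomodule H H :=
  {| coact := comul; coact_assoc := @coassoc K H; coact_counit := @counitr K H |}.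

Lemma balanced_conj p x : bilin p ->
  balanced (fun v0 v1 => p x (circ v0) *: circ v1).
Proof.
move=> [_ /(_ x) lp]; split=> [v v' w|v w w'|a v w].
- by rewrite circD (linear_add lp) scalerDl.
- by rewrite circD scalerDr.
- by rewrite !circZ (linear_scale lp) scalerA mulrC -scalerA.
Qed.

Lemma exists_right_invariant : compact_quantum_group H ->
  exists2 p, inner_product p & right_invariant p.
Proof.
move=> /(comodule_inner_product regular_comodule)[p ip pE]; exists p => // x v.
have [bp _ _] := ip.
have E := pE x (circ v); rewrite circK in E; apply: etrans E _.
rewrite [in LHS]/= (comul_circ_sum (tensor_repr (comul v))) tensor_lift_balanced.
  by apply: eq_bigr => c _; rewrite !circK.
exact: balanced_conj.
Qed.

(** The left regular coaction turned into a right one: S^-1 reverses the comultiplication, which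
    compensates for the swap of the legs. *)
Definition twisted_coact x : (H ⊗ H)%type :=
  sweedler (fun a b => b ⊗ skew_antipode a) x.

Lemma twisted_coact_linear : linear twisted_coact.
Proof. have lS := @skew_antipode_linear K H; rewrite /twisted_coact; lin. Qed.

HB.instance Definition _ :=
  GRing.isLinear.Build K H (H ⊗ H)%type *:%R twisted_coact twisted_coact_linear.

Lemma twisted_coact_assoc x :
  tensor_assoc (tensor_map twisted_coact idfun (twisted_coact x)) =
  tensor_map idfun comul (twisted_coact x).
Proof.
have lS := @skew_antipode_linear K H.
have lT := twisted_coact_linear.
have bM1 : bilin (fun v w : H => twisted_coact v ⊗ @idfun H w) by rewrite /idfun; lin.
have bM2 : bilin (fun v w : H => @idfun H v ⊗ comul w) by rewrite /idfun; lin.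
have bA0 (c : H) : bilin (fun a b : H => a ⊗ (b ⊗ c)) by lin.
have bA : bilin (fun (t : H ⊗ H) (c : H) => tensor_lift (fun a b => a ⊗ (b ⊗ c)) t).
  split=> [c|t]; first exact: tensor_lift_linear.
  apply: linear_sumf => p; lin.
rewrite {2 3}/twisted_coact /tensor_map /tensor_assoc.
rewrite (sweedler_linear _ _ (tensor_lift_linear bM2)).
rewrite (sweedler_linear _ _ (tensor_lift_linear bM1)).
rewrite (sweedler_linear _ _ (tensor_lift_linear bA)).
(* Both sides equal x_3 ⊗ (S^-1(x_2) ⊗ S^-1(x_1)). *)
transitivity (sweedler (fun a b => sweedler (fun c d =>
   d ⊗ (skew_antipode c ⊗ skew_antipode a)) b) x).
  apply: eq_sweedler => a b.
  rewrite [tensor_lift (fun v w => _ v ⊗ _) _]tensor_lift_pure; last exact: bilin_balanced.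
  rewrite tensor_lift_pure; last exact: bilin_balanced.
  rewrite /twisted_coact (sweedler_linear _ _ (tensor_lift_linear (bA0 _))).
  by apply: eq_sweedler => c d; rewrite tensor_lift_pure//; exact: bilin_balanced.
rewrite -sweedlerA; last by lin.
apply: eq_sweedler => a b.
rewrite tensor_lift_pure; last exact: bilin_balanced.
have -> : comul (skew_antipode a) =
    sweedler (fun c d => skew_antipode d ⊗ skew_antipode c) a.
  rewrite -sweedler_skew_antipode; last exact: bilin_tensor.
  exact: tensor_repr.
by rewrite (sweedler_linear _ _ ((bilin_tensor _ _).2 _)).
Qed.

Lemma twisted_coact_counit x :
  tensor_lift (fun v0 v1 => counit v1 *: v0) (twisted_coact x) = x.
Proof.
have lS := @skew_antipode_linear K H.
have b0 : bilin (fun v0 v1 : H => counit v1 *: v0) by lin.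
rewrite /twisted_coact (sweedler_linear _ _ (tensor_lift_linear b0)).
rewrite -[RHS](sweedler_counitl (f := id) x) //.
apply: eq_sweedler => a b; rewrite tensor_lift_pure; last exact: bilin_balanced.
by rewrite /skew_antipode counit_circ counit_antipode counit_circ conjCK.
Qed.

Definition twisted_comodule : rcomodule H H :=
  {| coact := twisted_coact; coact_assoc := twisted_coact_assoc;
     coact_counit := twisted_coact_counit |}.

Lemma exists_left_invariant : compact_quantum_group H ->
  exists2 p, inner_product p & left_invariant p.
Proof.
move=> /(comodule_inner_product twisted_comodule)[p ip pE]; exists p => // x v.
have [bp _ _] := ip.
have lS := @skew_antipode_linear K H.
have := pE x (circ v); rewrite circK /=.
rewrite {1}/twisted_coact.
have b1 : bilin (fun u0 u1 : H => p u0 v *: u1) by lin.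
rewrite (sweedler_linear _ _ (tensor_lift_linear b1)).
have -> : sweedler (fun a b => tensor_lift (fun u0 u1 => p u0 v *: u1)
    (b ⊗ skew_antipode a)) x = sweedler (fun x1 x2 => p x2 v *: skew_antipode x1) x.
  by apply: eq_sweedler => a b; rewrite tensor_lift_pure//; exact: bilin_balanced.
move=> ->; rewrite /twisted_coact sweedler_circ; last by lin.
rewrite /sweedler tensor_lift_balanced; last exact: balanced_conj.
by apply: eq_bigr => c _; rewrite /= /skew_antipode !circK.
Qed.

End Forms.

(** * Convolution and the integral *)

Lemma sweedler_mul (K : comNzRingType) (H : hopfAlgType K) (U : lmodType K)
    (f : H -> H -> U) x y : bilin f ->
  sweedler f (x * y) =
  sweedler (fun a b => sweedler (fun c d => f (a * c) (b * d)) y) x.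
Proof.
move=> bf; rewrite /sweedler comulM /tensor_mul.
rewrite (linear_bigsum _ _ (tensor_lift_linear bf)); apply: eq_bigr => p _.
rewrite (linear_bigsum _ _ (tensor_lift_linear bf)); apply: eq_bigr => q _.
by rewrite tensor_lift_pure//; exact: bilin_balanced.
Qed.

Section Convolution.
Variables (K : numClosedFieldType) (H : circHopfAlgType K).
Implicit Types (x y u v : H) (p q : H -> H -> K^o).

(** Both sides are the sum of p(x_1, v_3) q(x_2, v_2) r(x_3, v_1). *)
Lemma convolutionA p q r x v : bilin p -> bilin q -> bilin r ->
  convolution p (convolution q r) x v = convolution (convolution p q) r x v.
Proof.
move=> bp bq br.
transitivity (sweedler (fun x1 z => sweedler (fun x2 x3 =>
    sweedler (fun w v3 => sweedler (fun v1 v2 =>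
      p x1 v3 *: (q x2 v2 *: r x3 v1)) w) v) z) x).
  apply: eq_sweedler => x1 z; rewrite sweedlerC; apply: eq_sweedler => w v3.
  rewrite (sweedler_linear _ _ (@linear_scaler _ K^o K^o _ id (fun _ _ _ => erefl))).
  apply: eq_sweedler => x2 x3.
  by rewrite (sweedler_linear _ _ (@linear_scaler _ K^o K^o _ id (fun _ _ _ => erefl))).
rewrite -sweedlerA; last by lin.
apply: eq_sweedler => z x3.
transitivity (sweedler (fun x1 x2 => sweedler (fun v1 w => sweedler (fun v2 v3 =>
      p x1 v3 *: (q x2 v2 *: r x3 v1)) w) v) z).
  apply: eq_sweedler => x1 x2.
  by rewrite -(sweedlerA (F := fun v1 v2 v3 => p x1 v3 *: (q x2 v2 *: r x3 v1)))//; lin.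
rewrite sweedlerC; apply: eq_sweedler => v1 w.
rewrite (sweedler_linear _ _ (@linear_scalel _ K^o K^o id _ (fun _ _ _ => erefl))).
apply: eq_sweedler => x1 x2.
rewrite (sweedler_linear _ _ (@linear_scalel _ K^o K^o id _ (fun _ _ _ => erefl))).
by apply: eq_sweedler => v2 v3; rewrite scalerA.
Qed.

(** The factor p takes x_1 and the last leg of v and is merely carried along, while invariance of q
    acts on the remaining legs. *)
Lemma right_invariant_convolution p q : bilin p -> bilin q ->
  right_invariant q -> right_invariant (convolution p q).
Proof.
move=> bp bq Rq x v.
have sc (k : K) : linear (fun y : H => k *: y) by lin.
have sl (y : H) : linear (fun k : K^o => k *: y) by lin.
transitivity (sweedler (fun y x3 => sweedler (fun x1 x2 =>
    sweedler (fun v1 v2 => p x1 v2 *: (q x2 v1 *: x3)) v) y) x).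
  apply: eq_sweedler => y x3; rewrite (sweedler_linear _ _ (sl _)).
  apply: eq_sweedler => x1 x2; rewrite (sweedler_linear _ _ (sl _)).
  by apply: eq_sweedler => v1 v2; rewrite scalerA.
rewrite (sweedlerA (F := fun x1 x2 x3 =>
  sweedler (fun v1 v2 => p x1 v2 *: (q x2 v1 *: x3)) v)); last by lin.
transitivity (sweedler (fun x1 z => sweedler (fun v1 w => sweedler (fun v2 v3 =>
    p x1 v3 *: (q z v2 *: v1)) w) v) x).
  apply: eq_sweedler => x1 z; rewrite sweedlerC.
  rewrite -(sweedlerA (F := fun v1 v2 v3 => p x1 v3 *: (q z v2 *: v1))); last by lin.
  apply: eq_sweedler => v1 v2.
  rewrite -(sweedler_linear _ _ (sc (p x1 v2))) Rq.
  by rewrite (sweedler_linear _ _ (sc (p x1 v2))).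
rewrite sweedlerC; apply: eq_sweedler => v1 w.
rewrite (sweedler_linear _ _ (sl _)); apply: eq_sweedler => x1 z.
rewrite (sweedler_linear _ _ (sl _)); apply: eq_sweedler => v2 v3.
by rewrite scalerA.
Qed.

End Convolution.

Section Integral.
Variables (K : numClosedFieldType) (H : circHopfAlgType K) (phi : {scalar H}).
Hypothesis phi_int : normal_integral phi.
Implicit Types (x y u v : H) (p q : H -> H -> K^o).

Let lphi : linear (phi : H -> K^o).
Proof. by move=> a x y; rewrite linearP. Qed.

(** Both sides agree at 1. A simple subcoalgebra D other than C1 lies in the kernel of [phi] and its
    coproducts lie in D ⊗ D, so both sides vanish there. *)
Lemma normal_integral_invariant x :
  sweedler (fun a b => phi a *: b) x = phi x *: 1.
Proof.
have bf : bilin (fun a b : H => phi a *: b) by lin.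
have ls : linear (fun x => sweedler (fun a b : H => phi a *: b) x) by lin.
have [phi1 ker_phi] := phi_int.
have f1 : sweedler (fun a b => phi a *: b) 1 = 1.
  by rewrite /sweedler comul1 tensor_lift_pure ?phi1 ?scale1r//; exact: bilin_balanced.
have [s [xE sP]] : in_other_simples (x - phi x *: 1).
  by apply/ker_phi; rewrite linearB linearZ /= phi1 mulr1 subrr.
rewrite -[x in LHS](subrK (phi x *: 1)) (linear_add ls) (linear_scale ls) f1.
rewrite xE (linear_bigsum _ _ ls) big1_seq ?add0r// => y /= ys.
have [D [sD D1 yD]] := sP y ys.
have [[_ DP] _ _] := sD.
have [t [tD tE]] := DP y yD.
rewrite (sweedler_sum bf tE) big1_seq// => c /= ct.
have [c1D _] := tD c ct.
suff -> : phi c.1 = 0 by rewrite scale0r.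
apply/ker_phi; exists [:: c.1]; rewrite big_seq1; split=> // z; rewrite inE => /eqP ->.
by exists D.
Qed.

Definition integral_bilinear x v : K^o := phi (antipode v * x).
Local Notation h := integral_bilinear.

Lemma bilin_integral : bilin h.
Proof. rewrite /h; lin. Qed.

(** Invariance of [phi] at S(v_2) x produces the sum of phi(S(v_3) x_1) v_1 S(v_2) x_2, in which v_1
    S(v_2) cancels. *)
Lemma right_invariant_integral : right_invariant h.
Proof.
move=> x v.
have bf : bilin (fun a b : H => phi a *: b) by lin.
symmetry.
transitivity (sweedler (fun v1 w => sweedler (fun v2 v3 => sweedler (fun x1 x2 =>
    phi (antipode v3 * x1) *: (v1 * (antipode v2 * x2))) x) w) v).
  apply: eq_sweedler => v1 w.
  have lm : linear (fun y => v1 * y) by lin.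
  rewrite -[X in _ *: X]mulr1 scalerAr -normal_integral_invariant.
  rewrite sweedler_mul// sweedler_antipode; last by lin.
  rewrite (sweedler_linear _ _ lm); apply: eq_sweedler => v2 v3.
  rewrite (sweedler_linear _ _ lm); apply: eq_sweedler => x1 x2.
  by rewrite -scalerAr.
rewrite -(sweedlerA (F := fun v1 v2 v3 => sweedler (fun x1 x2 =>
    phi (antipode v3 * x1) *: (v1 * (antipode v2 * x2))) x)); last by lin.
rewrite -[RHS](sweedler_counitl
  (f := fun v => sweedler (fun x1 x2 => phi (antipode v * x1) *: x2) x)); last by lin.
apply: eq_sweedler => w v3; rewrite sweedlerC.
rewrite (sweedler_linear _ _ (@linear_scaler _ _ _ _ id (fun _ _ _ => erefl))).
apply: eq_sweedler => x1 x2.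
have lm : linear (fun y => phi (antipode v3 * x1) *: (y * x2)) by lin.
transitivity (phi (antipode v3 * x1) *: (sweedler (fun a b => a * antipode b) w * x2)).
  rewrite (sweedler_linear _ _ lm); apply: eq_sweedler => a b.
  by rewrite mulrA.
by rewrite sweedler_antipoder -scalerAl mul1r !scalerA mulrC.
Qed.

(** Left invariance moves the antipode from v to x. Then [phi] is evaluated at S^-1(x_2) x_1, which
    collapses to a counit times 1 by [skew_antipodel], and [phi 1 = 1]. *)
Lemma convolution_integral p x v : bilin p -> left_invariant p ->
  convolution h p x v = p x v.
Proof.
move=> bp Lp; have lS := @skew_antipode_linear K H.
pose psi : H -> K^o := phi; have lpsi : linear psi := lphi.
transitivity (sweedler (fun x1 z => sweedler (fun x2 x3 =>
   p x3 v *: psi (skew_antipode x2 * x1)) z) x).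
  apply: eq_sweedler => x1 z.
  have lm : linear (fun y => psi (y * x1)) by lin.
  transitivity (psi (sweedler (fun v1 v2 => p z v1 *: antipode v2) v * x1)).
    rewrite (sweedler_linear _ _ lm); apply: eq_sweedler => v1 v2.
    by rewrite -scalerAl (linear_scale lpsi); exact: mulrC.
  rewrite -Lp (sweedler_linear _ _ lm); apply: eq_sweedler => x2 x3.
  by rewrite -scalerAl (linear_scale lpsi).
rewrite -(sweedlerA (F := fun x1 x2 x3 => p x3 v *: psi (skew_antipode x2 * x1)));
  last by lin.
rewrite -[RHS](sweedler_counitl (f := p^~ v)); last exact: bp.1.
apply: eq_sweedler => w x3.
have lm : linear (fun y => p x3 v *: psi y) by lin.
rewrite -(sweedler_linear _ _ lm) skew_antipodel.
rewrite (linear_scale lpsi) [psi 1]phi_int.1 [_ *: 1]mulr1.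
exact: mulrC.
Qed.

End Integral.

(** * Orthogonalization and finite dimensional subcomodules *)

Section Positivity.
Variables (K : numClosedFieldType) (H : circHopfAlgType K).
Implicit Types (x y u v w : H) (p q : H -> H -> K^o) (a : seq H).

Lemma inner_product_eq0 p x : inner_product p -> p x (circ x) = 0 -> x = 0.
Proof.
move=> [_ _ pp] px; apply/eqP; apply: contraT => /pp.
by rewrite px ltxx.
Qed.

Lemma inner_product_sym p x y : inner_product p ->
  p x (circ y) = 0 -> p y (circ x) = 0.
Proof. by move=> [_ herm _] pxy; rewrite herm pxy conjC0. Qed.

(** Gram-Schmidt on the second legs, one pure tensor at a time. Only the values of [b] and [e] below
    [n] matter. *)
Lemma orthogonal_tensor p (t : H ⊗ H) : inner_product p ->
  exists n (b e : nat -> H), [/\ t = \sum_(i < n) b i ⊗ e i,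
    forall i, (i < n)%N -> e i != 0
    & forall i j, (i < n)%N -> (j < n)%N -> i != j -> p (e i) (circ (e j)) = 0].
Proof.
move=> ip; have [bp herm pos] := ip.
elim/tensor_ind: t => [|v w t [n [b [e [tE e0 eo]]]]].
  by exists 0%N, (fun=> 0), (fun=> 0); rewrite big_ord0.
pose c i : K := p w (circ (e i)) / p (e i) (circ (e i)).
pose w' := w - \sum_(i < n) c i *: e i.
have w'o j : (j < n)%N -> p w' (circ (e j)) = 0.
  move=> jn; have lj := bp.1 (circ (e j)).
  rewrite /w' -scaleN1r addrC lj (linear_bigsum _ _ lj) (bigD1 (Ordinal jn)) //=.
  rewrite (linear_scale lj) big1 ?addr0 => [|i ij].
    rewrite -[c j *: _]/(c j * _) /c divfK ?scaleN1r ?addNr//.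
    by rewrite gt_eqF// pos// e0.
  by rewrite (linear_scale lj) eo ?scaler0.
(* Replacing w by its component orthogonal to the [e i] shifts each first leg [b i] by
   [c i *: v]. *)
have tE' : v ⊗ w + t = \sum_(i < n) (b i + c i *: v) ⊗ e i + v ⊗ w'.
  have [Dl Dr Z] := tensor_pure_balanced H H.
  rewrite -[w in LHS](subrK (\sum_(i < n) c i *: e i)) -/w' Dr addrAC addrC.
  rewrite addrC (linear_bigsum _ _ ((bilin_tensor _ _).2 v)) tE -addrA.
  rewrite addrC -big_split /=; congr (_ + _); apply: eq_bigr => i _.
  by rewrite Dl Z addrC.
(* If [w'] vanishes no term is appended, which keeps all the [e i] nonzero. *)
have [w'0|w'0] := eqVneq w' 0.
  exists n, (fun i => b i + c i *: v), e; split=> //.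
  by rewrite tE' w'0 (linear_zero ((bilin_tensor _ _).2 v)) addr0.
exists n.+1, (fun i => if i == n then v else b i + c i *: v),
  (fun i => if i == n then w' else e i); split.
- rewrite big_ord_recr /= eqxx tE'; congr (_ + _).
  by apply: eq_bigr => i _; rewrite ltn_eqF.
- by move=> i; rewrite ltnS leq_eqVlt; case: eqVneq => //= _ /e0.
- move=> i j; rewrite !ltnS => ilen jlen ij.
  have lt k : (k <= n)%N -> k != n -> (k < n)%N by rewrite ltn_neqAle => -> ->.
  have [iE|ni] := eqVneq i n; have [jE|nj] := eqVneq j n.
  + by rewrite iE jE eqxx in ij.
  + exact/w'o/lt.
  + by apply: (inner_product_sym ip); exact/w'o/lt.
  + by apply: eo => //; exact: lt.
Qed.

Lemma convolution_sum p q x y I J (r : seq I) (s : seq J) F G F' G' :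
  bilin p -> bilin q ->
  comul x = \sum_(i <- r) F i ⊗ G i -> comul y = \sum_(j <- s) F' j ⊗ G' j ->
  convolution p q x (circ y) =
  \sum_(i <- r) \sum_(j <- s) p (F i) (circ (F' j)) * q (G i) (circ (G' j)).
Proof.
move=> bp bq xE yE; rewrite /convolution [LHS]/sweedler xE tensor_lift_balanced.
  apply: eq_bigr => i _.
  rewrite /sweedler (comul_circ_sum yE) tensor_lift_balanced//.
  by apply: bilin_balanced; lin.
by apply: bilin_balanced; lin.
Qed.

(** With Δx = Σ b_i ⊗ e_i and the e_i orthogonal for q, the value at (x, x) is Σ p(b_i, b_i) q(e_i,
    e_i). If it is 0, all b_i vanish, so Δx = 0 and the counit gives x = 0. *)
Lemma inner_product_convolution p q :
  inner_product p -> inner_product q -> inner_product (convolution p q).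
Proof.
move=> ip iq; have [bp hp pp] := ip; have [bq hq pq] := iq.
split; first exact: bilin_convolution.
  move=> x y.
  rewrite (convolution_sum bp bq (tensor_repr (comul x)) (tensor_repr (comul y))).
  rewrite (convolution_sum bp bq (tensor_repr (comul y)) (tensor_repr (comul x))).
  rewrite exchange_big rmorph_sum; apply: eq_bigr => i _.
  rewrite rmorph_sum; apply: eq_bigr => j _.
  by rewrite hp hq rmorphM.
move=> x x0.
have [n [b [e [xE e0 eo]]]] := orthogonal_tensor (comul x) iq.
have pge0 y : 0 <= p y (circ y).
  have [->|y0] := eqVneq y 0; last by rewrite ltW// pp.
  by rewrite (linear_zero (bp.1 _)).
have E : convolution p q x (circ x) =
    \sum_(i < n) p (b i) (circ (b i)) * q (e i) (circ (e i)).
  rewrite (convolution_sum bp bq xE xE); apply: eq_bigr => i _.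
  rewrite (bigD1 i)//= big1 ?addr0// => j ji.
  by rewrite eo ?mulr0// eq_sym.
have Ege0 i : (i < n)%N -> 0 <= p (b i) (circ (b i)) * q (e i) (circ (e i)).
  by move=> ni; rewrite mulr_ge0// ltW// pq// e0.
rewrite lt_def; apply/andP; split; last first.
  by rewrite E sumr_ge0// => i _; exact: Ege0.
rewrite E; apply: contra x0 => /eqP/psumr_eq0P E0.
have b0 (i : 'I_n) : b i = 0.
  apply: (inner_product_eq0 ip); apply/eqP.
  have /eqP := E0 (fun i _ => Ege0 i (ltn_ord i)) i isT.
  by rewrite mulf_eq0 => /orP[//|]; rewrite gt_eqF// pq// e0.
rewrite -(counitl x) xE big1 => [|i _].
  by rewrite (linear_zero (tensor_lift_linear _))//; lin.
by rewrite b0 (linear_zero ((bilin_tensor _ _).1 _)).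
Qed.

(* The linear span, encoded impredicatively to avoid coefficient families. *)
Definition spanned a x := forall P : H -> Prop, P 0 ->
  (forall k y z, P y -> P z -> P (k *: y + z)) -> {in a, forall y, P y} -> P x.

Lemma spanned_linear a k x y : spanned a x -> spanned a y -> spanned a (k *: x + y).
Proof. by move=> ax ay P P0 PD Pa; apply: (PD); [exact: ax|exact: ay]. Qed.

Lemma spanned0 a : spanned a 0. Proof. by move=> P. Qed.

Lemma spanned_mem a x : x \in a -> spanned a x.
Proof. by move=> xa P _ _; apply. Qed.

Lemma spanned_cons a x y : spanned a x -> spanned (y :: a) x.
Proof.
move=> ax P P0 PD Pa; apply: (ax P P0 PD) => z za; apply: Pa.
by rewrite inE za orbT.
Qed.

Lemma spanned_sum a n (F : 'I_n -> H) : (forall i, spanned a (F i)) ->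
  spanned a (\sum_(i < n) F i).
Proof.
move=> aF; apply: big_ind => [|x y ax ay|i _]; [exact: spanned0| |exact: aF].
by rewrite -[x]scale1r; apply: spanned_linear.
Qed.

(** Induction on the spanning list: a new generator is split into its projection onto the previous
    span and an orthogonal part, along which the representing vector is corrected. *)
Lemma riesz_spanned p (l : H -> K^o) a : inner_product p -> linear l ->
  exists2 w, spanned a w & forall y, spanned a y -> p w (circ y) = l (circ y).
Proof.
move=> ip ll; have [bp herm pos] := ip.
have ext (b : seq H) w (f : H -> K^o) : linear f ->
    {in b, forall y, p w (circ y) = f (circ y)} ->
    forall y, spanned b y -> p w (circ y) = f (circ y).
  move=> lf E y sy; apply: (sy (fun z => p w (circ z) = f (circ z))) => //.
    by rewrite circ0 (linear_zero (bp.2 w)) (linear_zero lf).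
  by move=> k u v Eu Ev; rewrite circD circZ (bp.2 w) lf Eu Ev.
elim: a => [|b a IH] in l ll *.
  by exists 0; [exact: spanned0 | exact: ext].
have [w aw wE] := IH l ll.
(* [u] is the orthogonal projection of [b] onto the span of [a]. *)
have [u au uE] := IH (p b) (bp.2 b).
pose v := b - u.
have spu : spanned (b :: a) v.
  rewrite /v -scaleN1r addrC; apply: spanned_linear; first exact: spanned_cons.
  by apply: spanned_mem; rewrite mem_head.
have vo y : spanned a y -> p v (circ y) = 0.
  move=> ay; rewrite /v -scaleN1r addrC (bp.1 (circ y)) uE// scaleN1r.
  exact: addNr.
have [v0|v0] := eqVneq v 0.
  have bu : b = u by apply/eqP; rewrite -subr_eq0 -/v v0.
  exists w; first exact: spanned_cons.
  apply: (ext) => // y; rewrite inE => /orP[/eqP ->|ya].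
    by rewrite bu; apply: wE.
  by apply: wE; apply: spanned_mem.
(* Adding a multiple of [v] leaves the values on the span of [a] unchanged; [k] makes the value at
   [b] correct. *)
pose k : K := (l (circ b) - p w (circ b)) / p v (circ v).
exists (k *: v + w); first by apply: spanned_linear => //; exact: spanned_cons.
apply: (ext) => // y; rewrite inE => /orP[/eqP ->|ya].
  have pvb : p v (circ b) = p v (circ v).
    by rewrite -[b](subrK u) -/v circD (linear_add (bp.2 v)) (vo u)// addr0.
  rewrite (bp.1 (circ b)) pvb -[k *: _]/(k * _) divfK ?subrK//.
  by rewrite gt_eqF// pos.
have ay := spanned_mem ya.
by rewrite (bp.1 (circ y)) vo// scaler0 add0r wE.
Qed.

(** The subcomodule is spanned by the first legs b_i of Δx, written with orthogonal second legs e_i.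
    Pairing the third leg of the iterated coproduct with e_i leaves a nonzero multiple of Δ(b_i) on
    one side and a sum of tensors b_j ⊗ f_j on the other. *)
Lemma finite_subcomodule p x : inner_product p ->
  exists2 a, spanned a x & forall y, spanned a y ->
    exists2 s : seq (H * H), comul y = \sum_(c <- s) c.1 ⊗ c.2 &
      {in s, forall c, spanned a c.1}.
Proof.
move=> ip; have [bp _ pos] := ip.
have [n [b [e [xE e0 eo]]]] := orthogonal_tensor (comul x) ip.
have ba (i : 'I_n) : b i \in [seq b i | i : 'I_n] by apply: map_f; rewrite mem_enum.
exists [seq b i | i : 'I_n].
  have b0 : bilin (fun u v : H => counit v *: u) by lin.
  rewrite -(counitr x) xE tensor_lift_balanced; last exact: bilin_balanced.
  apply: spanned_sum => i; rewrite -[_ *: _]addr0.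
  by apply: spanned_linear; [exact: spanned_mem|exact: spanned0].
move=> y sy; apply: (sy (fun z => exists2 s : seq (H * H),
    comul z = \sum_(c <- s) c.1 ⊗ c.2 & {in s, forall c, spanned _ c.1}))
  => [|k u v [s sE sa] [t tE ta]|_ /mapP[i _ ->]].
- by exists [::]; rewrite // big_nil linear0.
- exists ([seq (k *: c.1, c.2) | c <- s] ++ t).
    rewrite comul_linear sE tE big_cat big_map scaler_sumr; congr (_ + _).
    by apply: eq_bigr => c _; rewrite tensor_scale_pure.
  move=> c; rewrite mem_cat => /orP[/mapP[d ds ->]|/ta//].
  by rewrite /= -[_ *: _]addr0; apply: spanned_linear; [exact: sa|exact: spanned0].
pose l : K := p (e i) (circ (e i)).
have l0 : l != 0 by rewrite gt_eqF// pos// e0.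
pose f j := sweedler (fun c d => p d (circ (e i)) *: c) (e j).
have lE : l *: comul (b i) = \sum_(j < n) b j ⊗ f j.
  have bF : bilin (fun c d : H => c ⊗ d) by lin.
  have T : trilin (fun u v w : H => p w (circ (e i)) *: (u ⊗ v)) by lin.
  have := sweedlerA x T.
  rewrite {1 3}/sweedler xE !tensor_lift_balanced; try by apply: bilin_balanced; lin.
  rewrite (bigD1 i)//= [X in _ + X]big1 ?addr0 => [E|j ji]; last first.
    by rewrite eo// ; apply: big1 => c _; rewrite scale0r.
  rewrite [comul (b i)]tensor_repr scaler_sumr; apply: etrans E _.
  apply: eq_bigr => j _.
  rewrite (sweedler_linear _ _ ((bilin_tensor _ _).2 _)); apply: eq_sweedler => c d.
  by rewrite (linear_scale ((bilin_tensor _ _).2 _)).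
exists [seq (l^-1 *: b j, f j) | j : 'I_n].
  rewrite -[LHS]scale1r -(mulVf l0) -scalerA lE scaler_sumr big_map big_enum.
  by apply: eq_bigr => j _; rewrite tensor_scale_pure.
move=> _ /mapP[j _ ->] /=; rewrite -[_ *: _]addr0.
by apply: spanned_linear; [exact: spanned_mem|exact: spanned0].
Qed.

End Positivity.

(** * Positivity and hermitian symmetry of the integral form *)

Section IntegralForm.
Variables (K : numClosedFieldType) (H : circHopfAlgType K) (phi : {scalar H}).
Hypotheses (cqgH : compact_quantum_group H) (phi_int : normal_integral phi).
Implicit Types (x y u v w : H) (p q : H -> H -> K^o).
Local Notation h := (integral_bilinear phi).

Lemma convolution_circ p q x y (s : seq (H * H)) : bilin p -> bilin q ->
  comul y = \sum_(c <- s) c.1 ⊗ c.2 ->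
  convolution p q x (circ y) = \sum_(c <- s)
    q (sweedler (fun x1 x2 => p x1 (circ c.1) *: x2) x) (circ c.2).
Proof.
move=> bp bq yE; rewrite (convolution_sum bp bq (tensor_repr (comul x)) yE).
rewrite exchange_big; apply: eq_bigr => c _.
rewrite (sweedler_linear _ _ (bq.1 (circ c.2))); apply: eq_bigr => d _.
by rewrite (linear_scale (bq.1 _)).
Qed.

Lemma integral_form_gt0 x : x != 0 -> 0 < integral_form phi x x.
Proof.
move=> x0; rewrite -[integral_form _ _ _]/(h x (circ x)).
have [f fi Rf] := exists_right_invariant cqgH.
have [g gi Lg] := exists_left_invariant cqgH.
have [bf _ _] := fi; have [bg _ _] := gi.
have bh := bilin_integral phi.
have Rh := right_invariant_integral phi_int.
pose b := convolution g f.
have ib : inner_product b by apply: inner_product_convolution.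
have [bb hb _] := ib.
have Rb : right_invariant b by apply: right_invariant_convolution.
have hbE u v : convolution h b u v = b u v.
  rewrite convolutionA//; apply: eq_sweedler => u1 u2; apply: eq_sweedler => v1 v2.
  by rewrite (convolution_integral phi_int).
have [a ax aP] := finite_subcomodule x ib.
have [w aw wE] := riesz_spanned a ib (bh.2 x).
(* By right invariance both sides become sums over Δy, whose first legs stay in the span, where b(w,
   -) and h(x, -) agree. *)
have E y : spanned a y -> sweedler (fun w1 w2 => b w1 (circ y) *: w2) w =
    sweedler (fun x1 x2 => h x1 (circ y) *: x2) x.
  move=> /aP[s yE sa]; rewrite Rb Rh /sweedler (comul_circ_sum yE).
  rewrite !tensor_lift_balanced; try by apply: bilin_balanced; lin.
  by apply: eq_big_seq => c /sa ca; rewrite wE.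
(* [E] trades the first factor of b * b at w for h at x, and h * b = b. *)
have bbE y : spanned a y -> convolution b b w (circ y) = b x (circ y).
  move=> /aP[s yE sa]; rewrite -hbE !(convolution_circ _ _ _ yE)//.
  by apply: eq_big_seq => c /sa ca; rewrite E.
have w0 : w != 0.
  apply: contra x0 => /eqP w0; apply/eqP; apply: (inner_product_eq0 ib).
  have ibb := bilin_convolution bb bb.
  by rewrite -bbE// w0 (linear_zero (ibb.1 _)).
have [_ _ pbb] := inner_product_convolution ib ib.
(* Here y = w in [bbE]: h(x, x) = b(w, x) is the conjugate of b(x, w) = (b * b)(w, w). *)
by rewrite -wE// hb -bbE// geC0_conj ?pbb// ltW// pbb.
Qed.

(** Polarization: positivity makes h(u, u) real for every u, and u = x + y together with u = x + iy
    determines h(x, y) from h(y, x). *)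
Lemma integral_form_sym x y : integral_form phi x y = (integral_form phi y x)^*.
Proof.
have bh := bilin_integral phi.
pose F x y : K := h x (circ y).
have FDl u v w : F (u + v) w = F u w + F v w by apply: (linear_add (bh.1 _)).
have FDr u v w : F w (u + v) = F w u + F w v.
  by rewrite /F circD (linear_add (bh.2 w)).
have FZl a u v : F (a *: u) v = a * F u v by apply: (linear_scale (bh.1 _)).
have FZr a u v : F u (a *: v) = a^* * F u v.
  by rewrite /F circZ (linear_scale (bh.2 _)).
have Freal u : (F u u)^* = F u u.
  have [->|u0] := eqVneq u 0; first by rewrite /F (linear_zero (bh.1 _)) conjC0.
  by apply/CrealP/ger0_real/ltW/integral_form_gt0.
rewrite -[LHS]/(F x y) -[in RHS]/(F y x).
have E1 := Freal (x + y).
have E2 := Freal (x + 'i *: y).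
move: E1 E2; rewrite !FDl !FDr !FZl !FZr !rmorphD !rmorphM /=.
rewrite !(conjCi, rmorphN) /= ?conjCi !Freal ?opprK.
set A := F x y; set B := F y x; set X := F x x; set Y := F y y => E1 E2.
have S1 : A + B = A^* + B^*.
  apply: (addrI (X + Y)); transitivity (X + A + (B + Y)); first by ring.
  by rewrite -E1; ring.
(* This is the relation from x + iy after cancelling the factor i. *)
have S2 : B - A = A^* - B^*.
  apply: (mulfI (neq0Ci K)); apply: (addrI (X + Y)).
  transitivity (X + - 'i * A + ('i * B + 'i * (- 'i * Y)) + (1 + 'i * 'i) * Y).
    by ring.
  by rewrite -E2; ring : (sqrCi K).
have n2 : 2 != 0 :> K by rewrite pnatr_eq0.
apply: (mulfI n2); transitivity ((A + B) - (B - A)); first by ring.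
by rewrite S1 S2 -/(F y x) -/B; ring.
Qed.

End IntegralForm.

Theorem theorem6p7 (R : realType) (H : circHopfAlgType R[i]) (phi : {scalar H})
    (cqgH : compact_quantum_group H) (phi_int : normal_integral phi) :
  (exists f : {hermitian_sym H for conjC},
     forall x y : H, f x y = integral_form phi x y) /\
  (forall x : H, x != 0 -> 0 < integral_form phi x x).
Proof.
split; last by move=> x; exact: integral_form_gt0.
have bh := bilin_integral phi.
have bil : bilinear_for *%R (conjC \; *%R) (integral_form phi).
  split=> [y|x] a u v; first exact: (bh.1 (circ y) a u v).
  by rewrite /integral_form circD circZ; exact: (bh.2 x (a^*) _ _).
(* The sign exponent [false] selects the hermitian rather than the skew-hermitian case. *)
have herm x y : integral_form phi x y = (-1) ^+ false * (integral_form phi y x)^*.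
  by rewrite expr0 mul1r; exact: integral_form_sym.
pose m1 := bilinear_isBilinear.Build _ _ _ _ _ _ (integral_form phi) bil.
pose m2 := isHermitianSesquilinear.Build _ _ false conjC (integral_form phi) herm.
pose f : {hermitian_sym H for conjC} := HB.pack (integral_form phi) m1 m2.
by exists f.
Qed.
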